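(* Let $(X,\mathbb{X},\mu)$ be a measure space and let $p\in[1,\infty)$. Let $(f_n)$ be a sequence of measurable functions and $f$ a measurable function on $X$. Then $(f_n)$ converges to $f$ in $L_p$ if and only if both of the following conditions hold: (a) $(f_n)$ $\alpha_p$-converges to $f$; (b) for every sequence $(D_n)$ of measurable sets, if $\mu(D_n)\to 0$ as $n\to\infty$, then $\int_{D_n}|f_n-f|^p\,d\mu\to 0$ as $n\to\infty$.
   Context: Measurable functions are $\mathbb{X}$-measurable real-valued functions on $X$ (not assumed to belong to $L_p$); $(X,\mathbb{X},\mu)$ is an arbitrary measure space. For $B\in\mathbb{X}$, $B^c$ denotes the complement of $B$ in $X$. The sequence $(f_n)$ converges to $f$ in $L_p$ if $\int_X|f_n-f|^p\,d\mu\to 0$ as $n\to\infty$. The sequence $(f_n)$ is said to $\alpha_p$-converge to $f$ if there exists a sequence of measurable sets $(B_n)$ with $\mu(B_n^c)\to 0$ as $n\to\infty$ such that $\int_{B_n}|f_n-f|^p\,d\mu\to 0$ as $n\to\infty$. *)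

(* Defs.v *)
From HB Require Import structures.
From mathcomp Require Import all_boot all_order all_algebra.
From mathcomp Require Import all_classical all_reals all_analysis.
Import Order.TTheory GRing.Theory Num.Theory.
Import numFieldNormedType.Exports.

Set Implicit Arguments.
Unset Strict Implicit.
Unset Printing Implicit Defensive.

Local Open Scope classical_set_scope.
Local Open Scope ring_scope.
Local Open Scope ereal_scope.

(* All integrals and measures are extended-real valued, and limits are taken
   in \bar R: finitely many terms may be +oo, as in the usual definitions
   for measurable functions that are not assumed to belong to L_p. *)

Definition Lp_converges (d : measure_display) (T : measurableType d)
    (R : realType) (mu : {measure set T -> \bar R}) (p : R)
    (f_ : nat -> T -> R) (f : T -> R) : Prop :=
  (fun n => \int[mu]_(x in setT) (`|f_ n x - f x| `^ p)%:E) @ \oo --> 0.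

Definition alpha_converges (d : measure_display) (T : measurableType d)
    (R : realType) (mu : {measure set T -> \bar R}) (p : R)
    (f_ : nat -> T -> R) (f : T -> R) : Prop :=
  exists B : nat -> set T,
    [/\ forall n, measurable (B n),
        (fun n => mu (~` B n)) @ \oo --> 0 &
        (fun n => \int[mu]_(x in B n) (`|f_ n x - f x| `^ p)%:E) @ \oo --> 0].

(* Main.v *)
Require Import Defs.
From HB Require Import structures.
From mathcomp Require Import all_boot all_order all_algebra.
From mathcomp Require Import all_classical all_reals all_analysis.
From mathcomp Require Import measurable_realfun.
Import Order.TTheory GRing.Theory Num.Theory.
Import numFieldNormedType.Exports.

Local Open Scope classical_set_scope.
Local Open Scope ring_scope.
Local Open Scope ereal_scope.

(** The integrand [|f_n - f|^p] is nonnegative and measurable, so its integral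
    is monotone and additive in the domain, even when it is infinite.

    If the integrals over the whole space tend to [0], so do those over any
    measurable sets whatsoever: this gives (b), and (a) with every [B_n] equal
    to the whole space. Conversely, given the sets [B_n] of (a), the integral
    over the whole space is the sum of the integrals over [B_n], which tends to
    [0] by (a), and over the complement of [B_n], which tends to [0] by (b)
    since the measures of these complements tend to [0]. *)

Lemma measurable_dist_powR (d : measure_display) (T : measurableType d)
    (R : realType) (p : R) (g f : T -> R) :
  measurable_fun setT g -> measurable_fun setT f ->
  measurable_fun setT (fun x => `|g x - f x| `^ p)%R.
Proof.
move=> mg mf.
apply: (measurableT_comp (measurable_powR p)).
by apply: measurableT_comp => //; exact: measurable_funB.
Qed.

Lemma Lp_converges_integral_cvg0 (d : measure_display) (T : measurableType d)
    (R : realType) (mu : {measure set T -> \bar R}) (p : R)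
    (f_ : nat -> T -> R) (f : T -> R) (D : nat -> set T) :
  (forall n, measurable_fun setT (f_ n)) -> measurable_fun setT f ->
  (forall n, measurable (D n)) -> Lp_converges mu p f_ f ->
  (fun n => \int[mu]_(x in D n) (`|f_ n x - f x| `^ p)%:E) @ \oo --> 0.
Proof.
move=> mf_ mf mD cvgf.
apply: (squeeze_cvge _ (cvg_cst 0) cvgf); near=> n; apply/andP; split.
  by apply: integral_ge0 => x _; rewrite lee_fin powR_ge0.
apply: ge0_subset_integral => //; exact/measurable_EFinP/measurable_dist_powR.
Unshelve. all: by end_near. Qed.

Theorem proposition4p1 (d : measure_display) (T : measurableType d)
    (R : realType) (mu : {measure set T -> \bar R}) (p : R) (hp : (1 <= p)%R)
    (f_ : nat -> T -> R) (f : T -> R)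
    (mf_ : forall n, measurable_fun setT (f_ n)) (mf : measurable_fun setT f) :
  Lp_converges mu p f_ f <->
  (alpha_converges mu p f_ f /\
   forall D : nat -> set T,
     (forall n, measurable (D n)) ->
     (fun n => mu (D n)) @ \oo --> 0 ->
     (fun n => \int[mu]_(x in D n) (`|f_ n x - f x| `^ p)%:E) @ \oo --> 0).
Proof.
split=> [cvgf|[[B [mB muB0 intB0]] small]].
  split=> [|D mD _]; last exact: Lp_converges_integral_cvg0.
  exists (fun=> setT); split=> //.
  by rewrite setCT measure0; exact: cvg_cst.
have mBC n : measurable (~` B n) by exact: measurableC.
have intE n : \int[mu]_(x in setT) (`|f_ n x - f x| `^ p)%:E =
    \int[mu]_(x in B n) (`|f_ n x - f x| `^ p)%:E +
    \int[mu]_(x in ~` B n) (`|f_ n x - f x| `^ p)%:E.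
  rewrite -(setUv (B n)) ge0_integral_setU //.
  - by rewrite setUv; exact/measurable_EFinP/measurable_dist_powR.
  - by rewrite disj_set2E setICr.
rewrite /Lp_converges (funext intE) -[X in _ --> X]adde0.
exact: cvgeD intB0 (small _ mBC muB0).
Qed.
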